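(* Let $m, K \geq 1$ be integers, let $\Pi$ be a set of policies, let $V : \Pi \to [0,1]^m$ be the (fixed, unknown) value function, and let $\hat V : \Pi \to [0,1]^m$ be a random function (an estimate of $V$ computed from data). So $V_i(\pi), \hat V_i(\pi) \in [0,1]$ for all $i \in [m]$ and $\pi \in \Pi$. Let $c_i(\pi) \geq 0$ for $i \in [m]$, $\pi \in \Pi$, and suppose that, with probability at least $1-\delta$, the bounds $|V_i(\pi) - \hat V_i(\pi)| \leq c_i(\pi)$ hold jointly for all $i \in [m]$ and all $\pi \in \Pi$. Let $S_* = \arg\max_{S \subseteq \Pi : |S| = K} \mathrm{vol}(S, V)$. Let $\mathrm{Oracle}$ be an $\alpha$-approximate oracle, $\alpha \in [0,1]$, and let $\hat S = \mathrm{Oracle}(\mathrm{vol}(\cdot, \hat V))$. Then with probability at least $1-\delta$, $$\mathrm{vol}(\hat S, V) \;\geq\; \alpha\, \mathrm{vol}(S_*, V) - c(S_* ) - c(\hat S),$$ where $c(S) = \sum_{\pi \in S} \sum_{i=1}^m c_i(\pi)$.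
   Context: Notation: $[m] = \{1,\dots,m\}$. For a function $W : \Pi \to [0,1]^m$, $W_i(\pi)$ denotes the $i$-th entry of $W(\pi)$. Hypervolume: for $S \subseteq \Pi$ and $W : \Pi \to [0,1]^m$, $$\mathrm{vol}(S, W) = \int_{y \in [0,1]^m} \mathbf{1}\{\exists\, \pi \in S : y \leq W(\pi)\}\, dy,$$ where $y \leq W(\pi)$ is meant entry-wise; that is, the Lebesgue measure of $\bigcup_{\pi \in S} \prod_{i=1}^m [0, W_i(\pi)]$. $\alpha$-approximate oracle: a map that, for any function $\tilde V : \Pi \to [0,1]^m$, computes a set of $K$ policies $\tilde S = \mathrm{Oracle}(\mathrm{vol}(\cdot, \tilde V)) \subseteq \Pi$ such that $$\mathrm{vol}(\tilde S, \tilde V) \geq \alpha \max_{S \subseteq \Pi : |S| = K} \mathrm{vol}(S, \tilde V),$$ i.e. $\mathrm{vol}(\tilde S, \tilde V) \geq \alpha\, \mathrm{vol}(S, \tilde V)$ for every $S \subseteq \Pi$ with $|S| = K$. The maximizer $S_*$ is assumed to exist (any maximizer may be taken). The policies enter only through the values $V(\pi)$, $\hat V(\pi)$, $c_i(\pi)$, so $\Pi$ may be treated as an abstract set. *)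

(* Defs.v *)
From HB Require Import structures.
From mathcomp Require Import all_boot all_order all_algebra finmap.
From mathcomp Require Import all_classical all_reals all_analysis.

Set Implicit Arguments.
Unset Strict Implicit.
Unset Printing Implicit Defensive.
Import Order.TTheory GRing.Theory Num.Theory.
Import numFieldNormedType.Exports.

Local Open Scope classical_set_scope.
Local Open Scope ring_scope.

Section sigma_finite_measure_of.
Context d (T : measurableType d) (R : realType) (f : set T -> \bar R).
Context (f0 : f set0 = 0%E) (f_ge0 : forall A, (0 <= f A)%E).
Context (f_add : semi_sigma_additive f) (f_fin : sigma_finite setT f).

Local Definition mk_measure := f.
HB.instance Definition _ := isMeasure.Build d T R mk_measure f0 f_ge0 f_add.
HB.instance Definition _ := Measure_isSigmaFinite.Build d T R mk_measure f_fin.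

Local Lemma sigma_finite_measure_of :
  exists mu : {sigma_finite_measure set T -> \bar R}, f = mu.
Proof. by exists mk_measure. Qed.

End sigma_finite_measure_of.

Section lebesgue_tuple.
Context {R : realType}.
Local Notation mR := (measurableTypeR R).
Implicit Types n : nat.

Definition tcons n (p : mR * n.-tuple mR) : n.+1.-tuple mR :=
  [tuple of p.1 :: p.2].

(* n-dimensional Lebesgue measure, by R^(n+1) = R x R^n starting from a point
   mass on R^0; see [lebesgue_tuple_box] for its value on boxes. *)
Fixpoint lebesgue_tuple n : set (n.-tuple mR) -> \bar R :=
  match n with
  | 0 => \d_([tuple] : 0.-tuple mR)
  | n'.+1 => pushforward (lebesgue_measure \x @lebesgue_tuple n')%E
               (@tcons n')
  end.

Lemma measurable_tcons n : measurable_fun setT (@tcons n).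
Proof. exact: measurable_cons. Qed.

Definition tbox n (A : 'I_n -> set mR) : set (n.-tuple mR) :=
  [set t | forall i, A i (tnth t i)].

Lemma tcons_tbox n (A : 'I_n.+1 -> set mR) :
  @tcons n @^-1` tbox A = A ord0 `*` tbox (fun i => A (lift ord0 i)).
Proof.
apply/seteqP; split => [[x t] /= At|[x t] [/= Ax At] i].
  split; first exact: (At ord0).
  by move=> i /=; have := At (lift ord0 i); rewrite tnthS.
by case: (unliftP ord0 i) => [j|] ->; [rewrite tnthS; exact: At|].
Qed.

Lemma measurable_tbox n (A : 'I_n -> set mR) :
  (forall i, measurable (A i)) -> measurable (tbox A).
Proof.
move=> mA.
have -> : tbox A = \bigcap_(i in [set: 'I_n]) ((@tnth n mR)^~ i @^-1` A i).
  by apply/seteqP; split => [t At i _|t At i]; exact: At.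
apply: fin_bigcap_measurable => // i _.
by rewrite -[X in measurable X]setTI; exact: measurable_tnth.
Qed.

Section step.
Variables (n : nat) (mu : {sigma_finite_measure set (n.-tuple mR) -> \bar R}).
Let nu : {measure set (mR * n.-tuple mR) -> \bar R} := (lebesgue_measure \x mu)%E.

Let step_sigma_finite : sigma_finite setT (pushforward nu (@tcons n)).
Proof.
have /sigma_finiteP[F [FT Fnd Foo]] := sigma_finiteT (@lebesgue_measure R).
have /sigma_finiteP[G [GT Gnd Goo]] := sigma_finiteT mu.
pose B k : set (n.+1.-tuple mR) :=
  [set t | F k (tnth t ord0) /\ G k [tuple of behead t]].
exists B.
  apply/seteqP; split => // t _.
  have : setT (tnth t ord0) by [].
  rewrite FT => -[i _ Fi].
  have : setT ([tuple of behead t] : n.-tuple mR) by [].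
  rewrite GT => -[j _ Gj].
  exists (maxn i j) => //; split.
    by move: Fi; apply/subsetPset/Fnd/leq_maxl.
  by move: Gj; apply/subsetPset/Gnd/leq_maxr.
move=> k; have [mF Flt] := Foo k; have [mG Glt] := Goo k; split.
  apply: measurableI; rewrite -[X in measurable X]setTI.
    exact: measurable_tnth.
  exact: measurable_behead.
rewrite /pushforward; have -> : @tcons n @^-1` B k = F k `*` G k.
  apply/funext => -[x t]; congr (F k _ /\ G k _).
  exact: val_inj.
by rewrite /nu/= product_measure1E// lte_mul_pinfty// ge0_fin_numE.
Qed.

Lemma pushforward_tcons_sigma_finite_measure :
  exists mu' : {sigma_finite_measure set (n.+1.-tuple mR) -> \bar R},
    pushforward nu (@tcons n) = mu'.
Proof.
apply: sigma_finite_measure_of => //.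
- by rewrite /pushforward preimage_set0 measure0.
- by move=> A; rewrite /pushforward; exact: measure_ge0.
- move=> F mF tF mUF.
  have mpre A : measurable A -> measurable (@tcons n @^-1` A).
    by move=> mA; rewrite -[X in measurable X]setTI; exact: measurable_tcons.
  rewrite /pushforward preimage_bigcup; apply: measure_semi_sigma_additive.
  + by move=> k; exact: mpre.
  + apply/trivIsetP => /= i j _ _ ij; rewrite -preimage_setI.
    by move/trivIsetP : tF => /(_ _ _ _ _ ij) ->//; rewrite preimage_set0.
  + by rewrite -preimage_bigcup; exact: mpre.
Qed.

End step.

Lemma lebesgue_tuple_sigma_finite_measure n :
  exists mu : {sigma_finite_measure set (n.-tuple mR) -> \bar R},
    @lebesgue_tuple n = mu.
Proof.
elim: n => [|n [mu lmu]]; first by eexists.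
by rewrite /= lmu; exact: pushforward_tcons_sigma_finite_measure.
Qed.

Let lt0 n : @lebesgue_tuple n set0 = 0%E.
Proof. by have [mu ->] := lebesgue_tuple_sigma_finite_measure n. Qed.

Let lt_ge0 n A : (0 <= @lebesgue_tuple n A)%E.
Proof. by have [mu ->] := lebesgue_tuple_sigma_finite_measure n. Qed.

Let lt_add n : semi_sigma_additive (@lebesgue_tuple n).
Proof.
have [mu ->] := lebesgue_tuple_sigma_finite_measure n.
exact: measure_semi_sigma_additive.
Qed.

Let lt_fin n : sigma_finite setT (@lebesgue_tuple n).
Proof.
have [mu ->] := lebesgue_tuple_sigma_finite_measure n.
exact: sigma_finiteT.
Qed.

HB.instance Definition _ n := isMeasure.Build _ _ _ (@lebesgue_tuple n)
  (@lt0 n) (@lt_ge0 n) (@lt_add n).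

HB.instance Definition _ n := Measure_isSigmaFinite.Build _ _ _
  (@lebesgue_tuple n) (@lt_fin n).

Lemma lebesgue_tuple_box n (A : 'I_n -> set mR) :
  (forall i, measurable (A i)) ->
  lebesgue_tuple (tbox A) = (\prod_(i < n) lebesgue_measure (A i))%E.
Proof.
elim: n A => [|n IH] A mA.
  by rewrite big_ord0 /= diracE mem_set// => -[].
rewrite big_ord_recl -IH//= /pushforward tcons_tbox product_measure1E//.
exact: measurable_tbox.
Qed.

End lebesgue_tuple.

Definition unit_cube (R : realType) (m : nat) :
    set (m.-tuple (measurableTypeR R)) :=
  [set y | forall i, (0 : R) <= tnth y i <= 1].
Arguments unit_cube : clear implicits.

Definition vol (R : realType) (m : nat) (Pi : Type) (S : set Pi)
    (W : Pi -> m.-tuple R) : \bar R :=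
  (\int[@lebesgue_tuple R m]_(y in unit_cube R m)
    (\1_[set y : m.-tuple R |
       exists2 p, S p & forall i, tnth y i <= tnth (W p) i] y)%:E)%E.

Lemma vol1 (R : realType) (m : nat) (Pi : Type) (p : Pi)
    (W : Pi -> m.-tuple R) : unit_cube R m (W p) ->
  vol [set p] W = (\prod_(i < m) tnth (W p) i)%:E.
Proof.
move=> W01; rewrite /vol.
have cubeE : unit_cube R m = tbox (fun _ => [set` `[0 : R, 1]] : set (measurableTypeR R)).
  by apply/seteqP; split => y /= y01 i; have := y01 i; rewrite /= in_itv.
set E := [set y | _].
have EE : E = tbox (fun i => [set` `]-oo, tnth (W p) i]] : set (measurableTypeR R)).
  apply/seteqP; split => [y [_ -> yW] i|y yW] /=; first by rewrite in_itv/= yW.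
  by exists p => // i; have := yW i; rewrite /= in_itv.
have mC : measurable (unit_cube R m) by rewrite cubeE; exact: measurable_tbox.
have mE : measurable (E : set (m.-tuple (measurableTypeR R))).
  by rewrite EE; exact: measurable_tbox.
rewrite integral_indic//.
have -> : E `&` unit_cube R m =
    tbox (fun i => [set` `[0 : R, tnth (W p) i]] : set (measurableTypeR R)).
  apply/seteqP; split => [y [[_ -> yW] y01] i|y yW] /=.
    by rewrite in_itv/= yW andbT; case/andP: (y01 i).
  have yW' i : 0 <= tnth y i <= tnth (W p) i by have := yW i; rewrite /= in_itv.
  split; first by exists p => // i; case/andP: (yW' i).
  move=> i; case/andP: (yW' i) => -> /= /le_trans; apply.
  by case/andP: (W01 i).
transitivity (\prod_(i < m) lebesgue_measure
    ([set` `[0%R : R, tnth (W p) i]] : set (measurableTypeR R)))%E.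
  by apply: lebesgue_tuple_box.
rewrite -prodEFin; apply: eq_bigr => i _.
have /andP[+ _] := W01 i; rewrite lebesgue_measure_itv/= lte_fin.
by rewrite le_eqVlt => /predU1P[<-|->]; rewrite ?ltxx// oppr0 adde0.
Qed.

(* Joint events over an arbitrary Pi need not be measurable: "A holds with
   probability at least q" means that A contains a measurable event of
   probability at least q. *)
Definition prob_ge d (T : measurableType d) (R : realType)
    (P : probability T R) (q : R) (A : set T) : Prop :=
  exists E, [/\ measurable E, E `<=` A & (q%:E <= P E)%E].

Lemma prob_geE d (T : measurableType d) (R : realType)
    (P : probability T R) (q : R) (A : set T) :
  measurable A -> prob_ge P q A <-> (q%:E <= P A)%E.
Proof.
move=> mA; split=> [[E [mE EA qE]]|qA]; last by exists A; split.
by apply: (le_trans qE); rewrite le_measure ?inE.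
Qed.

Definition is_vol_argmax (R : realType) (m : nat) (Pi : choiceType) (K : nat)
    (V : Pi -> m.-tuple R) (S : {fset Pi}) : Prop :=
  #|` S| = K /\
  forall S' : {fset Pi}, #|` S'| = K -> (vol [set` S'] V <= vol [set` S] V)%E.

(* An oracle only sees the set function vol(., W), not W itself. *)
Definition is_approx_oracle (R : realType) (m : nat) (Pi : choiceType)
    (K : nat) (alpha : R) (Oracle : (set Pi -> \bar R) -> {fset Pi}) : Prop :=
  forall W : Pi -> m.-tuple R, (forall p, unit_cube R m (W p)) ->
    let S := Oracle (fun A => vol A W) in
    #|` S| = K /\
    forall S' : {fset Pi}, #|` S'| = K ->
      (alpha%:E * vol [set` S'] W <= vol [set` S] W)%E.

Definition width (R : realType) (m : nat) (Pi : choiceType)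
    (c : 'I_m -> Pi -> R) (S : {fset Pi}) : R :=
  \sum_(p <- S) \sum_(i < m) c i p.

(* Main.v *)
(* On the event |V - Vhat| <= c, exchanging V for Vhat changes vol(S, .) by at
   most c(S). Do this at Shat, use the oracle guarantee for Vhat against Sstar,
   and exchange back at Sstar, where alpha <= 1 absorbs the factor on c(Sstar).
*)
Require Import Defs.
From HB Require Import structures.
From mathcomp Require Import all_boot all_order all_algebra finmap.
From mathcomp Require Import lra.
From mathcomp Require Import all_classical all_reals all_analysis.

Set Implicit Arguments.
Unset Strict Implicit.
Unset Printing Implicit Defensive.
Import Order.TTheory GRing.Theory Num.Theory.
Import numFieldNormedType.Exports.

Local Open Scope classical_set_scope.
Local Open Scope ring_scope.

Lemma measure_bigsetU_le d (T : measurableType d) (R : realType)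
    (mu : {measure set T -> \bar R}) (I : eqType) (s : seq I) (F : I -> set T) :
  (forall i, i \in s -> measurable (F i)) ->
  (mu (\big[setU/set0]_(i <- s) F i) <= \sum_(i <- s) mu (F i))%E.
Proof.
elim: s => [|i s IH] mF; first by rewrite !big_nil measure0.
have mFs j : j \in s -> measurable (F j).
  by move=> js; apply: mF; rewrite in_cons js orbT.
rewrite !big_cons; apply: (le_trans (measureU2 _ _ _)).
- by apply: mF; rewrite mem_head.
- by rewrite big_seq; apply: bigsetU_measurable => j; exact: mFs.
- by rewrite leeD2l// IH.
Qed.

Section volume.
Context {R : realType} (m : nat).
Local Notation mR := (measurableTypeR R).
Local Notation leb := (@lebesgue_tuple R m).

Let unit_cubeE :
  unit_cube R m = tbox (fun _ => [set` `[0 : R, 1]] : set mR).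
Proof. by apply/seteqP; split => y y01 i; have := y01 i; rewrite /= in_itv. Qed.

Lemma measurable_unit_cube : measurable (unit_cube R m).
Proof. by rewrite unit_cubeE; exact: measurable_tbox. Qed.

Lemma lebesgue_unit_cube : leb (unit_cube R m) = 1%E.
Proof.
rewrite unit_cubeE lebesgue_tuple_box// big1// => i _.
by have := lebesgue_measure_itv `[0 : R, 1]; rewrite /= lte_fin ltr01 oppr0 adde0.
Qed.

(** The interval is open at [a] because failing [tnth y i <= a] is a strict inequality. For [b <= a]
    the slab is empty, so no sign condition on [b - a] is required. *)
Definition slab (i : 'I_m) (a b : R) : set (m.-tuple mR) :=
  tbox (fun j => [set` if j == i then `]a, b] else `[0, 1]] : set mR).

Lemma measurable_slab i a b : measurable (slab i a b).
Proof. by apply: measurable_tbox => j; exact: measurable_itv. Qed.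

(** The measure of a box is a product in which every factor except the [i]-th is the length 1 of the
    unit interval. *)
Lemma lebesgue_slab_le i a b c : `|b - a| <= c -> (leb (slab i a b) <= c%:E)%E.
Proof.
move=> bac; rewrite lebesgue_tuple_box => [|j]; last exact: measurable_itv.
rewrite (bigD1 i)//= eqxx big1 ?mule1 => [|j /negbTE ->]; last first.
  by have := lebesgue_measure_itv `[0 : R, 1]; rewrite /= lte_fin ltr01 oppr0 adde0.
have := lebesgue_measure_itv `]a, b]; rewrite /= => ->.
(* For [b <= a] the length is 0, and [c] is nonnegative because it bounds an absolute value. *)
case: ifPn => _; last by rewrite lee_fin (le_trans _ bac).
by rewrite lee_fin (le_trans (ler_norm _)).
Qed.

Context {Pi : choiceType}.
Implicit Types (W : Pi -> m.-tuple R) (S : {fset Pi}).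

Definition dominated (S : set Pi) W : set (m.-tuple mR) :=
  [set y | exists2 p, S p & forall i, tnth y i <= tnth (W p) i].

(** Since [S] is finite, this is a finite union of closed lower orthants, each of them a box. *)
Lemma measurable_dominated S W : measurable (dominated [set` S] W).
Proof.
have -> : dominated [set` S] W = \bigcup_(p in [set` S])
    tbox (fun i => [set` `]-oo, tnth (W p) i]] : set mR).
  by apply/seteqP; split => y [p Sp yW]; exists p.
apply: fin_bigcup_measurable => [|p _]; first exact: finite_fset.
exact: measurable_tbox.
Qed.

Lemma volE S W :
  vol [set` S] W = leb (dominated [set` S] W `&` unit_cube R m).
Proof.
apply: integral_indic; first exact: measurable_unit_cube.
exact: measurable_dominated.
Qed.

(** Finiteness allows the final inequalities to be moved from the extended reals to [R]. *)
Lemma vol_fin_num S W : vol [set` S] W \is a fin_num.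
Proof.
have mC := measurable_unit_cube; have mD := measurable_dominated S W.
rewrite volE ge0_fin_numE ?measure_ge0//.
apply: (@le_lt_trans _ _ (leb (unit_cube R m))).
  by apply: le_measure; rewrite ?inE//; exact: measurableI.
by rewrite lebesgue_unit_cube ltry.
Qed.

(* A point dominated under [W] but not under [W'] lies in a slab
   [W'_i(p) < y_i <= W_i(p)] of the cube, for some [p] in [S] and some [i]. *)
Lemma vol_perturb (c : 'I_m -> Pi -> R) S W W' :
  (forall i p, `|tnth (W p) i - tnth (W' p) i| <= c i p) ->
  (vol [set` S] W <= vol [set` S] W' + (width c S)%:E)%E.
Proof.
move=> Wc; rewrite !volE.
have mC := measurable_unit_cube.
have mD W0 : measurable (dominated [set` S] W0 `&` unit_cube R m).
  by apply: measurableI => //; exact: measurable_dominated.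
pose slabs p :=
  \big[setU/set0]_(i < m) slab i (tnth (W' p) i) (tnth (W p) i).
have mslabs p : measurable (slabs p).
  by apply: bigsetU_measurable => i _; exact: measurable_slab.
have mU : measurable (\big[setU/set0]_(p <- S) slabs p).
  exact: bigsetU_measurable.
apply: (@le_trans _ _ (leb ((dominated [set` S] W' `&` unit_cube R m) `|`
    \big[setU/set0]_(p <- S) slabs p))).
  apply: le_measure; rewrite ?inE//; first exact: measurableU.
  move=> y [[p Sp yW] y01].
  have [yW'|/existsNP[i /negP]] := pselect (forall i, tnth y i <= tnth (W' p) i).
    by left; split => //; exists p.
  rewrite -ltNge => W'y; right.
  rewrite -bigcup_seq; exists p => //=.
  rewrite /slabs -bigcup_seq; exists i; first exact: mem_index_enum.
  (* Coordinate [i] lies between the two values of [p]; the others are bounded only by the cube. *)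
  move=> j /=; case: eqP => [->|_]; rewrite /= in_itv /=; first by rewrite W'y yW.
  exact: y01.
(* Subadditivity is applied three times: to split off the slabs, then over policies, then over
   coordinates. This yields the double sum [width c S]. *)
apply: (le_trans (measureU2 _ _ _)) => //.
rewrite leeD2l// (le_trans (measure_bigsetU_le _ _))//.
rewrite /width -sumEFin; apply: lee_sum => p _.
apply: (le_trans (measure_bigsetU_le _ _)) => [i _|]; first exact: measurable_slab.
rewrite -sumEFin; apply: lee_sum => i _.
exact: lebesgue_slab_le.
Qed.

End volume.

Theorem theorem1 (R : realType) (d : measure_display) (Omega : measurableType d)
    (P : probability Omega R) (m K : nat) (Pi : choiceType)
    (V : Pi -> m.-tuple R) (Vhat : Omega -> Pi -> m.-tuple R)
    (c : 'I_m -> Pi -> R) (delta alpha : R)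
    (Oracle : (set Pi -> \bar R) -> {fset Pi}) (Sstar : {fset Pi}) :
  (0 < m)%N -> (0 < K)%N ->
  (forall p, unit_cube R m (V p)) ->
  (forall w p, unit_cube R m (Vhat w p)) ->
  (forall p, measurable_fun setT (Vhat ^~ p)) ->
  (forall i p, 0 <= c i p) ->
  prob_ge P (1 - delta)
    [set w | forall i p, `|tnth (V p) i - tnth (Vhat w p) i| <= c i p] ->
  is_vol_argmax K V Sstar ->
  0 <= alpha <= 1 ->
  is_approx_oracle m K alpha Oracle ->
  let Shat w := Oracle (fun A => vol A (Vhat w)) in
  prob_ge P (1 - delta)
    [set w | (alpha%:E * vol [set` Sstar] V
                - (width c Sstar)%:E - (width c (Shat w))%:E
              <= vol [set` Shat w] V)%E].
Proof.
move=> _ _ _ Vhat01 _ c0 [E [mE EA qE]] [cardS _] /andP[a0 a1] oracle Shat.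
(* The event given by the hypothesis serves for the conclusion too: from here on the argument is
   deterministic, at a fixed [w] in [E]. *)
exists E; split => // w /EA /= Vc; rewrite -/(Shat w).
have [_ /(_ _ cardS)] := oracle _ (Vhat01 w); rewrite -/(Shat w).
have := vol_perturb Sstar Vc.
have Vc' i p : `|tnth (Vhat w p) i - tnth (V p) i| <= c i p by rewrite distrC.
have := vol_perturb (Shat w) Vc'.
have wS0 : 0 <= width c Sstar by apply: sumr_ge0 => p _; exact: sumr_ge0.
rewrite -(fineK (vol_fin_num Sstar V)) -(fineK (vol_fin_num Sstar (Vhat w))).
rewrite -(fineK (vol_fin_num (Shat w) V)).
rewrite -(fineK (vol_fin_num (Shat w) (Vhat w))).
rewrite -!EFinM -!EFinD -?EFinN -?EFinD !lee_fin.
move: (fine _) (fine _) (fine _) (fine _) => x y z t h1 h2 h3.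
(* Here [h1] is the exchange at [Shat w], [h2] the exchange at [Sstar] and [h3] the oracle bound.
   Once [h2] is scaled by [alpha], what remains is linear in the products with [alpha]. *)
have := ler_wpM2l a0 h2; have := ler_wpM2r wS0 a1; rewrite mulrDr mul1r.
lra.
Qed.
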